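(* Every cycle $C_n$ ($n\ge 3$) is contractible.
   Context: All graphs are finite and simple (no loops or multiple edges). Let $G$ and $H$ be graphs with $V(H)\subseteq V(G)$. An $H$-scheme in $G$ is a collection of paths $\{P_{uv}: uv\in E(H)\}$ such that (1) each $P_{uv}$ is a $u,v$-path in $G$ with $V(P_{uv})\cap V(H)=\{u,v\}$, and (2) whenever $e_1,\dots,e_k\in E(H)$ satisfy $V(P_{e_1})\cap\dots\cap V(P_{e_k})\neq\emptyset$, there is a vertex $u\in V(H)$ incident with each of $e_1,\dots,e_k$. $G$ has a rooted $H$-minor if there are pairwise vertex-disjoint connected subgraphs $C_v$ of $G$, one for each $v\in V(H)$, such that $v\in V(C_v)$ for all $v\in V(H)$ and for each edge $uv\in E(H)$ there is an edge of $G$ joining $C_u$ and $C_v$. A graph $H$ is contractible if every graph $G$ with $V(H)\subseteq V(G)$ that contains an $H$-scheme has a rooted $H$-minor. *)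

(* Defs.v *)
From mathcomp Require Import all_boot.

Set Implicit Arguments.
Unset Strict Implicit.
Unset Printing Implicit Defensive.

Record sgraph := SGraph {
  vertex :> finType;
  adj : rel vertex;
  adj_sym : symmetric adj;
  adj_irr : irreflexive adj }.

Definition edges (G : sgraph) : {set {set G}} :=
  [set e : {set G} | [exists u, exists v, adj u v && (e == [set u; v])]].

(* A path is given by its sequence of vertices, listed from u to v. *)
Definition uv_path (G : sgraph) (u v : G) (s : seq G) : bool :=
  if s is x :: p then
    [&& x == u, last x p == v, path (@adj G) x p & uniq (x :: p)]
  else false.

(* The inclusion V(H) \subseteq V(G) is rendered by an injection f : H -> G,
   with no relation assumed between the edges of H and those of G.
   The path P e is indexed by the unordered edge e; its values outside the edge
   set of H are irrelevant, and so is the direction in which it is listed. *)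
Definition is_scheme (H G : sgraph) (f : H -> G) (P : {set H} -> seq G) : Prop :=
  (forall e : {set H}, e \in edges H ->
     (exists u v : H, e = [set u; v] /\ uv_path (f u) (f v) (P e)) /\
     (forall w : H, (f w \in P e) = (w \in e))) /\
  (forall F : {set {set H}}, F != set0 -> F \subset edges H ->
     (exists x : G, forall e : {set H}, e \in F -> x \in P e) ->
     exists u : H, forall e : {set H}, e \in F -> u \in e).

Record subgraph (G : sgraph) := Subgraph {
  sub_vertices : {set G};
  sub_adj : rel G;
  sub_adj_sym : symmetric sub_adj;
  sub_adjW : forall x y : G, sub_adj x y ->
    [&& x \in sub_vertices, y \in sub_vertices & adj x y] }.

Definition connected_subgraph (G : sgraph) (C : subgraph G) : Prop :=
  sub_vertices C != set0 /\
  {in sub_vertices C &, forall x y : G, connect (sub_adj C) x y}.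

Definition has_rooted_minor (H G : sgraph) (f : H -> G) : Prop :=
  exists C : H -> subgraph G,
    [/\ forall v : H, connected_subgraph (C v),
        forall u v : H, u != v ->
          [disjoint sub_vertices (C u) & sub_vertices (C v)],
        forall v : H, f v \in sub_vertices (C v)
      & forall u v : H, adj u v ->
          exists x y : G,
            [/\ x \in sub_vertices (C u), y \in sub_vertices (C v) & adj x y]].

Definition contractible (H : sgraph) : Prop :=
  forall (G : sgraph) (f : H -> G), injective f ->
    (exists P : {set H} -> seq G, is_scheme f P) -> has_rooted_minor f.

(* ordS is the successor modulo n; the conjunct i != j is automatic for n >= 2
   and only serves to make the definition total in n. *)
Definition cycle_adj (n : nat) : rel 'I_n :=
  fun i j => (i != j) && ((j == ordS i) || (i == ordS j)).

Lemma cycle_adj_sym (n : nat) : symmetric (@cycle_adj n).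
Proof. by move=> i j; rewrite /cycle_adj eq_sym orbC. Qed.

Lemma cycle_adj_irr (n : nat) : irreflexive (@cycle_adj n).
Proof. by move=> i; rewrite /cycle_adj eqxx. Qed.

Definition cycle_graph (n : nat) : sgraph :=
  SGraph (@cycle_adj_sym n) (@cycle_adj_irr n).

(* Main.v *)
(* Let P_i be the path from the root v_i to v_(i+1).  Every vertex lies on at
   most two paths, and these are consecutive.  Induct on the number of vertices
   in the union of the paths.  On each P_i let s_i be the first vertex after v_i
   that lies on another path.  If s_i is on P_(i-1) for some i, it replaces v_i
   as a root.  Otherwise s_i is on P_(i+1) for all i.  If s_(i+1) = v_(i+2), then
   s_i = v_(i+1), because the other inner vertices of P_(i+1) are on no other
   path; so s_i = v_(i+1) for all i or for none.  In the first case P_i without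
   its last vertex can be taken as the i-th branch set.  In the second case the
   s_i are roots of a scheme formed by the segments of P_(i+1) between s_(i+1)
   and s_i.  Each time, the vertices from v_i up to the new root are not used by
   the new scheme and can be added to the branch set of the new root. *)
Require Import Defs.
From mathcomp Require Import all_boot.

Set Implicit Arguments.
Unset Strict Implicit.
Unset Printing Implicit Defensive.

(** * Cyclic successor, repetition-free lists, connectivity inside a vertex set *)

Lemma ordS_neq n (i : 'I_n) : 1 < n -> ordS i != i.
Proof.
move=> n1; apply/eqP => /(congr1 val) /=.
have [lt|le] := ltnP i.+1 n; first by rewrite modn_small // => /eqP; rewrite eqn_leq ltnn.
have -> : i.+1 = n by apply/eqP; rewrite eqn_leq le ltn_ord.
by rewrite modnn => i0; move: le; rewrite -i0 leqNgt n1.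
Qed.

Lemma ordS2_neq n (i : 'I_n) : 2 < n -> ordS (ordS i) != i.
Proof.
move=> n2; apply/eqP => /(congr1 val) /=.
have n1 : 1 < n by apply: ltnW.
rewrite -addn1 modnDml addn1.
have [lt|le] := ltnP i.+2 n.
  by rewrite modn_small // => /eqP; rewrite eqn_leq ltnNge leqnSn.
(* When the count wraps, the double successor is 1 for [i = n - 1] and 0 for [i = n - 2]; being
   equal to [i] would force [n = 2] in both cases. *)
have := ltn_ord i; rewrite leq_eqVlt => /orP [/eqP ni|lt].
  rewrite -[X in X.+2 %% _]/(val i) -[in X in X %% _]addn1 ni addn1 -addn1.
  rewrite modnDl modn_small // => i1.
  by move: n2; rewrite -ni -i1.
have -> : i.+2 = n by apply/eqP; rewrite eqn_leq le lt.
by rewrite modnn => i0; move: le; rewrite -i0 leqNgt n2.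
Qed.

(** From any [j], the index [i] is reached in [i + (n - j)] successor steps, so the property travels
    back from [i] to [j]. *)
Lemma ordS_closed_all n (Q : pred 'I_n) (i : 'I_n) :
  (forall j, Q (ordS j) -> Q j) -> Q i -> forall j, Q j.
Proof.
move=> QS Qi j.
have iterQ k : Q (iter k (@ordS n) j) -> Q j.
  by elim: k => //= k IH /QS.
apply: (iterQ (i + (n - j))).
suff -> : iter (i + (n - j)) (@ordS n) j = i by [].
apply: val_inj.
have -> k : val (iter k (@ordS n) j) = (j + k) %% n.
  elim: k => [|k IH] /=; first by rewrite addn0 modn_small.
  by rewrite IH -addn1 modnDml -addnA addn1.
by rewrite addnCA subnKC 1?ltnW // modnDr modn_small.
Qed.

Lemma last_uniq_nil (T : eqType) (x z : T) (s t : seq T) :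
  uniq (x :: s ++ z :: t) -> last x (s ++ z :: t) = z -> t = [::].
Proof.
case/lastP: t => // t y; rewrite last_cat /= last_rcons => /= /andP [_].
by rewrite cat_uniq /= mem_rcons inE => /and3P [_ _ /andP [/norP [/eqP nyz _] _]] /esym.
Qed.

Definition restrict (G : sgraph) (C : {set G}) (x y : G) : bool :=
  [&& x \in C, y \in C & adj x y].

Lemma path_connect_restrict (G : sgraph) (C : {set G}) (x : G) (p : seq G) :
  path (@adj G) x p -> {subset x :: p <= C} ->
  {in x :: p, forall y, connect (restrict C) x y}.
Proof.
elim: p x => [|z p IH] x /=; first by move=> _ _ y; rewrite inE => /eqP ->.
move=> /andP [xz zp] sub y; rewrite inE => /orP [/eqP -> //|yp].
have zC : {subset z :: p <= C} by move=> w wp; apply: sub; rewrite inE wp orbT.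
apply: connect_trans (IH z zp zC y yp); apply: connect1.
  by rewrite /restrict xz !sub ?inE ?eqxx ?orbT.
Qed.

(** * Schemes of a cycle and their branch sets *)

(** The i-th path is [v i :: p i]. The last two clauses express condition (2) of a scheme; for
    [n = 3] only the fifth has content. For [n > 2] it also yields condition (1): a root lies on the
    two paths ending there, hence on no third. *)
Definition cyclic_scheme n (G : sgraph) (v : 'I_n -> G) (p : 'I_n -> seq G) : Prop :=
  [/\ forall i, path (@adj G) (v i) (p i),
      forall i, last (v i) (p i) = v (ordS i),
      forall i, uniq (v i :: p i),
      forall i j x, x \in v i :: p i -> x \in v j :: p j ->
        [\/ i = j, j = ordS i | i = ordS j]
    & forall i j k x, x \in v i :: p i -> x \in v j :: p j -> x \in v k :: p k ->
        [\/ i = j, j = k | i = k]].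

Definition scheme_support n (G : sgraph) (v : 'I_n -> G) (p : 'I_n -> seq G) : {set G} :=
  [set x | [exists i, x \in v i :: p i]].

(** The bound [U] guarantees that vertices outside a smaller scheme are still free to enlarge its
    branch sets. *)
Definition cyclic_minor_in n (G : sgraph) (v : 'I_n -> G) (U : {set G}) : Prop :=
  exists C : 'I_n -> {set G},
    [/\ forall i, v i \in C i,
        forall i x, x \in C i -> connect (restrict (C i)) (v i) x,
        forall i j x, x \in C i -> x \in C j -> i = j,
        forall i, exists x y, [/\ x \in C i, y \in C (ordS i) & adj x y]
      & forall i, C i \subset U].

Lemma mem_support n (G : sgraph) (v : 'I_n -> G) (p : 'I_n -> seq G) i x :
  x \in v i :: p i -> x \in scheme_support v p.
Proof. by move=> xi; rewrite inE; apply/existsP; exists i. Qed.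

(** The path [q i] links the root [v i] to [v' i], which is already in the i-th branch set. Hence
    only [belast] is added, and it is disjoint from [U'] and so from all old branch sets. *)
Lemma extend_minor n (G : sgraph) (v v' : 'I_n -> G) (q : 'I_n -> seq G) (U U' : {set G}) :
  (forall i, path (@adj G) (v i) (q i)) ->
  (forall i, last (v i) (q i) = v' i) ->
  (forall i x, x \in belast (v i) (q i) -> x \in U :\: U') ->
  (forall i j x, x \in belast (v i) (q i) -> x \in belast (v j) (q j) -> i = j) ->
  U' \subset U ->
  cyclic_minor_in v' U' -> cyclic_minor_in v U.
Proof.
move=> qP qL qU qD UU [C [Cv Cc Cd Ca CU]].
pose E i := C i :|: [set x in belast (v i) (q i)].
have CE i x : x \in C i -> x \in E i by rewrite inE => ->.
have qE i : {subset v i :: q i <= E i}.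
  move=> x; rewrite lastI mem_rcons inE qL => /orP [/eqP ->|xq]; first exact: CE.
  by rewrite !inE xq orbT.
have not_CD i j x : x \in C i -> x \in belast (v j) (q j) -> False.
  by move=> /(subsetP (CU i)) xU /qU; rewrite inE xU.
exists E; split=> [i|i x|i j x|i|i].
- by apply: qE; rewrite inE eqxx.
- have cq := path_connect_restrict (qP i) (@qE i).
  rewrite inE => /orP [xC|]; last first.
    by rewrite inE => xq; apply: cq; rewrite lastI mem_rcons inE xq orbT.
  apply: (@connect_trans _ _ (v' i)); first by apply: cq; rewrite -qL mem_last.
  apply: connect_sub (Cc i x xC) => a b /and3P [aC bC ab].
  by apply: connect1; rewrite /restrict ab !CE.
- rewrite !inE => /orP [xi|xi] /orP [xj|xj].
  + exact: Cd xi xj.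
  + by case: (not_CD _ _ _ xi xj).
  + by case: (not_CD _ _ _ xj xi).
  + exact: qD xi xj.
- by have [x [y [xC yC xy]]] := Ca i; exists x, y; split=> //; apply: CE.
- apply/subsetP => x; rewrite inE => /orP [/(subsetP (CU i))/(subsetP UU) //|].
  by rewrite inE => /qU; rewrite inE => /andP [].
Qed.

Lemma two_paths n (G : sgraph) (v : 'I_n -> G) (p : 'I_n -> seq G) i j x :
  2 < n -> cyclic_scheme v p ->
  x \in v i :: p i -> x \in v (ordS i) :: p (ordS i) -> x \in v j :: p j ->
  j = i \/ j = ordS i.
Proof.
move=> n2 [_ _ _ _ three] xi xSi xj.
have := ordS_neq i (ltnW n2).
by case: (three _ _ _ _ xi xSi xj) => [<-|->|->]; rewrite ?eqxx; auto.
Qed.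

Lemma next_root_mem n (G : sgraph) (v : 'I_n -> G) (p : 'I_n -> seq G) i :
  cyclic_scheme v p -> v (ordS i) \in v i :: p i.
Proof. by case=> _ <- _ _ _; apply: mem_last. Qed.

Lemma three_paths n (G : sgraph) (v : 'I_n -> G) (p : 'I_n -> seq G) i x :
  2 < n -> cyclic_scheme v p ->
  x \in v i :: p i -> x \in v (ordS i) :: p (ordS i) ->
  x \in v (ordS (ordS i)) :: p (ordS (ordS i)) -> False.
Proof.
move=> n2 S xi xSi xSSi; case: (two_paths n2 S xi xSi xSSi) => /eqP.
  by rewrite (negPf (ordS2_neq i n2)).
by rewrite (negPf (ordS_neq _ (ltnW n2))).
Qed.

(** The root [v (ordS i)] lies on the paths [i] and [ordS i] only. If it equals [v (ordS j)], then
    [j] and [ordS j] are both among these two indices, which forces [j = i] when [n > 2]. *)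
Lemma root_inj n (G : sgraph) (v : 'I_n -> G) (p : 'I_n -> seq G) :
  2 < n -> cyclic_scheme v p -> injective v.
Proof.
move=> n2 S i j vij.
rewrite -(ord_predK i) -(ord_predK j) in vij *.
move: (ord_pred i) (ord_pred j) vij => {}i {}j vij; congr ordS.
have h1 := next_root_mem i S; have h2 := mem_head (v (ordS i)) (p (ordS i)).
have h3 := next_root_mem j S; rewrite -vij in h3.
have h4 : v (ordS i) \in v (ordS j) :: p (ordS j) by rewrite vij mem_head.
case: (two_paths n2 S h1 h2 h3) => [//|ji].
have := two_paths n2 S h1 h2 h4; rewrite ji => -[] /eqP.
  by rewrite (negPf (ordS2_neq i n2)).
by rewrite (negPf (ordS_neq _ (ltnW n2))).
Qed.

(** * The two ways of moving roots *)

(* The new paths between y and its neighbouring roots are the part of the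
   path [k] before y and the part of the path [ordS k] after y. *)
Lemma reroot_minor n (G : sgraph) (v : 'I_n -> G) (p : 'I_n -> seq G) k y A B :
  2 < n -> cyclic_scheme v p ->
  p (ordS k) = A ++ y :: B -> y \in v k :: p k ->
  (forall j x, x \in A -> x \in v j :: p j -> j = ordS k) ->
  (forall (v' : 'I_n -> G) p', cyclic_scheme v' p' ->
     scheme_support v' p' \proper scheme_support v p ->
     cyclic_minor_in v' (scheme_support v' p')) ->
  cyclic_minor_in v (scheme_support v p).
Proof.
move=> n2 S pk yk Apriv IH; have [pathP lastP uniqP consec three] := S.
have ySk : y \in v (ordS k) :: p (ordS k).
  by rewrite pk inE mem_cat mem_head !orbT.
have Skk : (ordS k == k) = false by apply/negbTE/ordS_neq/ltnW.
have yNv : y != v (ordS k).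
  have := uniqP (ordS k); rewrite pk /= mem_cat inE eq_sym.
  by case/andP => /norP [_ /norP []].
(* If [y] were [v k], it would lie on the path before [k] as well, hence on three paths. *)
have : y \in p k.
  move: yk; rewrite inE => /orP [/eqP yvk|//].
  case: (@three_paths _ _ _ _ (ord_pred k) y n2 S); rewrite ?ord_predK // yvk.
    by have := next_root_mem (ord_pred k) S; rewrite ord_predK.
  by rewrite mem_head.
case/splitPr defp: {1}(p k) / => [L M].
pose v' j := if j == ordS k then y else v j.
pose p' j := if j == ordS k then B else if j == k then rcons L y else p j.
have vk' : v' k = v k by rewrite /v' eq_sym Skk.
have pk' : p' k = rcons L y by rewrite /p' eq_sym Skk eqxx.
have vSk' : v' (ordS k) = y by rewrite /v' eqxx.
have pSk' : p' (ordS k) = B by rewrite /p' eqxx.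
have vj' j : j != ordS k -> v' j = v j by rewrite /v' => /negbTE ->.
have pj' j : j != ordS k -> j != k -> p' j = p j by rewrite /p' => /negbTE -> /negbTE ->.
have sub j x : x \in v' j :: p' j -> x \in v j :: p j.
  have [->|jS] := eqVneq j (ordS k).
    by rewrite vSk' pSk' pk -cat_cons mem_cat => ->; rewrite orbT.
  rewrite vj' //; have [->|jk] := eqVneq j k; last by rewrite pj'.
  rewrite pk' defp !inE mem_rcons mem_cat !inE.
  by case/or3P => ->; rewrite ?orbT.
have S' : cyclic_scheme v' p'.
  split.
  - move=> j; have [->|jS] := eqVneq j (ordS k).
      by have := pathP (ordS k); rewrite vSk' pSk' pk cat_path /= => /and3P [].
    rewrite vj' //; have [->|jk] := eqVneq j k; last by rewrite pj'.
    have := pathP k; rewrite pk' defp -cat_rcons cat_path => /andP [] //.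
  - move=> j; have [->|jS] := eqVneq j (ordS k).
      rewrite vSk' pSk' vj' ?ordS_neq 1?ltnW //.
      by rewrite -lastP pk last_cat.
    rewrite vj' //; have [->|jk] := eqVneq j k; first by rewrite pk' last_rcons vSk'.
    rewrite pj' // lastP vj' //; apply: contra jk => /eqP SjSk.
    by apply/eqP; apply: (can_inj (@ordSK n)).
  - move=> j; have [->|jS] := eqVneq j (ordS k).
      have := uniqP (ordS k); rewrite vSk' pSk' pk -cat_cons cat_uniq.
      by case/and3P.
    rewrite vj' //; have [->|jk] := eqVneq j k; last by rewrite pj'.
    have := uniqP k; rewrite pk' defp -cat_rcons -cat_cons cat_uniq.
    by case/andP.
  - by move=> i j x /sub xi /sub xj; apply: consec xi xj.
  - by move=> i j l x /sub xi /sub xj /sub xl; apply: three xi xj xl.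
have UU : scheme_support v' p' \subset scheme_support v p.
  by apply/subsetP => x; rewrite inE => /existsP [j /sub]; apply: mem_support.
(* Only the old path [ordS k] meets [A], and its part from [y] on does not. The root [v (ordS k)]
   lies on the paths [k] and [ordS k] only; it comes after [y] on the first and before [y] on the
   second. *)
have dropped x : x \in v (ordS k) :: A -> x \notin scheme_support v' p'.
  move=> xA; apply/negP; rewrite inE => /existsP [j xj].
  have [jS|jS] := eqVneq j (ordS k).
    have := uniqP (ordS k); rewrite pk -cat_cons cat_uniq.
    rewrite jS vSk' pSk' in xj.
    by case/and3P => _ /hasPn /(_ x xj); rewrite /= xA.
  move: xA; rewrite inE => /orP [/eqP xv|xA]; last first.
    by move: jS; rewrite (Apriv _ _ xA (sub _ _ xj)) eqxx.
  rewrite xv in xj.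
  case: (two_paths n2 S (next_root_mem k S) (mem_head _ _) (sub _ _ xj)) => [jk|/eqP].
    have vM : v (ordS k) \in M.
      have := lastP k; rewrite defp last_cat /=; case: (M) => [/= yv|m M' /= <-].
        by rewrite yv eqxx in yNv.
      exact: mem_last.
    have := uniqP k; rewrite defp -cat_rcons -cat_cons cat_uniq.
    rewrite jk vk' pk' in xj; by case/and3P => _ /hasPn /(_ _ vM); rewrite /= xj.
  by rewrite (negPf jS).
have vU : v (ordS k) \in scheme_support v p by apply: mem_support (mem_head _ _).
have prop : scheme_support v' p' \proper scheme_support v p.
  by rewrite properE UU; apply/subsetPn; exists (v (ordS k)) => //; apply/dropped/mem_head.
apply: (@extend_minor _ _ v v' (fun j => if j == ordS k then rcons A y else [::])
  _ (scheme_support v' p') _ _ _ _ UU (IH _ _ S' prop)) => [j|j|j x|i j x].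
- case: eqP => // ->.
  by have := pathP (ordS k); rewrite pk -cat_rcons cat_path => /andP [].
- by case: ifP => jk; rewrite ?last_rcons /v' jk.
- case: eqP => // -> ; rewrite belast_rcons => xA; rewrite inE dropped //=.
  apply: (@mem_support _ _ _ _ (ordS k)); rewrite pk inE mem_cat.
  by move: xA; rewrite inE => /orP [] ->; rewrite ?orbT.
- by case: eqP => // ->; case: eqP => // ->.
Qed.

(* Each root v i is moved to s i, and the new path from s i to s (ordS i) is
   the part of the old path [ordS i] between these two vertices, reversed. *)
Lemma rotate_minor n (G : sgraph) (v s : 'I_n -> G) (p A B : 'I_n -> seq G) :
  2 < n -> cyclic_scheme v p ->
  (forall i, p i = A i ++ s i :: B i) ->
  (forall i j x, x \in A i -> x \in v j :: p j -> j = i) ->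
  (forall i, s i \in v (ordS i) :: p (ordS i)) ->
  (forall i, s i != v (ordS i)) ->
  (forall (v' : 'I_n -> G) p', cyclic_scheme v' p' ->
     scheme_support v' p' \proper scheme_support v p ->
     cyclic_minor_in v' (scheme_support v' p')) ->
  cyclic_minor_in v (scheme_support v p).
Proof.
move=> n2 S pE Apriv sS sNv IH; have [pathP lastP uniqP consec three] := S.
have si i : s i \in v i :: p i by rewrite pE inE mem_cat mem_head !orbT.
(* On the path [ordS i], the vertex [s i] is not in the private part [A (ordS i)], and it is not
   [s (ordS i)], which would lie on three paths. *)
have sB i : s i \in B (ordS i).
  have := sS i; rewrite inE (negPf (sNv i)) /= pE mem_cat inE.
  case/or3P => [sA|/eqP ss|//].
    by have := ordS_neq i (ltnW n2); rewrite -(Apriv _ _ _ sA (si i)) eqxx.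
  by case: (three_paths n2 S (si i) (sS i)); rewrite ss.
have splitB i : exists LM : seq G * seq G, B (ordS i) = LM.1 ++ s i :: LM.2.
  by have := sB i; case/splitPr => L M; exists (L, M).
have [LM BE] := fin_all_exists splitB.
pose L i := (LM i).1; pose M i := (LM i).2.
pose q i := rcons (rev (L i)) (s (ordS i)).
have qE i : s i :: q i = rev (s (ordS i) :: rcons (L i) (s i)).
  by rewrite rev_cons rev_rcons.
have pSE i : v (ordS i) :: p (ordS i) =
    (v (ordS i) :: A (ordS i)) ++ (s (ordS i) :: rcons (L i) (s i)) ++ M i.
  by rewrite pE BE /= cat_rcons.
(* The new path [i] lies inside the old path [ordS i]; as [ordS] is injective, the intersection
   clauses carry over. *)
have sub i x : x \in s i :: q i -> x \in v (ordS i) :: p (ordS i).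
  by rewrite qE mem_rev pSE !mem_cat => ->; rewrite orbT.
have inS := can_inj (@ordSK n).
have S' : cyclic_scheme s q.
  split.
  - move=> i; have := pathP (ordS i).
    rewrite pE BE cat_path /= -cat_rcons cat_path => /and3P [_ _ /andP [sp _]].
    have := rev_path (@adj G) (s (ordS i)) (rcons (L i) (s i)).
    rewrite last_rcons belast_rcons rev_cons => ->.
    by rewrite (eq_path (e' := @adj G)) // => a b; rewrite adj_sym.
  - by move=> i; rewrite last_rcons.
  - move=> i; rewrite qE rev_uniq.
    by have := uniqP (ordS i); rewrite pSE !cat_uniq => /and5P [].
  - move=> i j x /sub xi /sub xj.
    case: (consec _ _ _ xi xj) => [/inS|/inS|/inS]; by [constructor 1|constructor 2|constructor 3].
  - move=> i j k x /sub xi /sub xj /sub xk.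
    case: (three _ _ _ _ xi xj xk) => /inS; by [constructor 1|constructor 2|constructor 3].
have UU : scheme_support s q \subset scheme_support v p.
  by apply/subsetP => x; rewrite inE => /existsP [j /sub]; apply: mem_support.
have dropped_head i x : x \in v (ordS i) :: A (ordS i) -> x \notin s i :: q i.
  move=> xA; apply: contraL xA; rewrite qE mem_rev => xq.
  have := uniqP (ordS i); rewrite pSE cat_uniq => /and3P [_ /hasPn + _].
  by apply; rewrite mem_cat xq.
(* The end of the path [ordS i] is not [s i], since it would then lie on three paths; so it comes
   after [s i], in [M i]. *)
have dropped_last i : v (ordS (ordS i)) \notin s i :: q i.
  have vM : v (ordS (ordS i)) \in M i.
    have := lastP (ordS i); rewrite pE BE last_cat /= last_cat /=.
    rewrite -/(M i); case: (M i) => [/= sv|m M' /= <-]; last exact: mem_last.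
    case: (three_paths n2 S (si i) (sS i)); rewrite sv; exact: mem_head.
  rewrite qE mem_rev; have := uniqP (ordS i); rewrite pSE catA cat_uniq.
  case/and3P => _ /hasPn /(_ _ vM) + _.
  by rewrite mem_cat negb_or => /andP [].
(* A new path [j] containing [x] lies in the old path [ordS j]. If [ordS j] is [i], then [x]
   precedes the segment used. Otherwise [x] is [v i], the end of the old path [ordS j], and
   [dropped_last] applies. *)
have dropped i x : x \in v i :: A i -> x \notin scheme_support s q.
  move=> xA; apply/negP; rewrite inE => /existsP [j xj].
  have [jSi|jSi] := eqVneq (ordS j) i.
    by move: xj; apply/negP/dropped_head; rewrite jSi.
  move: (xA); rewrite inE => /orP [/eqP xv|/Apriv /(_ (sub _ _ xj))/eqP]; last first.
    by rewrite (negPf jSi).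
  have := next_root_mem (ord_pred i) S; have := mem_head (v i) (p i).
  rewrite -{2 3}(ord_predK i) -{1}(ord_predK i) => h1 h2.
  have := sub _ _ xj; rewrite xv -{1}(ord_predK i) => h3.
  case: (two_paths n2 S h2 h1 h3) => [jpi|/eqP]; last by rewrite ord_predK (negPf jSi).
  by move: xj; apply/negP; rewrite xv -(ord_predK i) -jpi dropped_last.
have prop : scheme_support s q \proper scheme_support v p.
  pose i0 := Ordinal (ltnW (ltnW n2)).
  rewrite properE UU; apply/subsetPn; exists (v i0); last exact/dropped/mem_head.
  by apply: mem_support (mem_head _ _).
apply: (@extend_minor _ _ v s (fun i => rcons (A i) (s i)) _ (scheme_support s q)
  _ _ _ _ UU (IH _ _ S' prop)) => [i|i|i x|i j x].
- by have := pathP i; rewrite pE -cat_rcons cat_path => /andP [].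
- by rewrite last_rcons.
- rewrite belast_rcons => xA; rewrite inE (dropped i) //=.
  apply: (@mem_support _ _ _ _ i); rewrite pE inE mem_cat.
  by move: xA; rewrite inE => /orP [] ->; rewrite ?orbT.
- rewrite !belast_rcons => xi xj.
  have [//|ij] := eqVneq i j.
  have mem k y : y \in v k :: A k -> y \in v k :: p k.
    by rewrite pE -cat_cons mem_cat => ->.
  move: (xi) (xj); rewrite !inE => /orP [/eqP xvi|xAi] /orP [/eqP xvj|xAj].
  + by apply: (root_inj n2 S); rewrite -xvi.
  + exact: Apriv xAj (mem _ _ xi).
  + exact/esym/(Apriv _ _ _ xAi (mem _ _ xj)).
  + exact: Apriv xAj (mem _ _ xi).
Qed.

(** * The induction on the support *)

Lemma scheme_minor n (G : sgraph) (v : 'I_n -> G) (p : 'I_n -> seq G) :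
  2 < n -> cyclic_scheme v p -> cyclic_minor_in v (scheme_support v p).
Proof.
move=> n2; move: {2}_.+1 (ltnSn #|scheme_support v p|) => m.
elim: m => // m IHm in v p *; rewrite ltnS => Um S.
have IH (v' : 'I_n -> G) p' : cyclic_scheme v' p' ->
    scheme_support v' p' \proper scheme_support v p ->
    cyclic_minor_in v' (scheme_support v' p').
  by move=> S' /proper_card lt; apply: IHm => //; apply: leq_trans Um.
have [pathP lastP uniqP consec three] := S.
pose shared i x := [exists j, (j != i) && (x \in v j :: p j)].
have vS_p i : v (ordS i) \in p i.
  have := next_root_mem i S; rewrite inE => /orP [/eqP/(root_inj n2 S)/eqP|//].
  by rewrite (negPf (ordS_neq _ (ltnW n2))).
(* A first shared vertex exists because the end [v (ordS i)] is shared with the path [ordS i]. *)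
have splitp i : exists t : seq G * G * seq G,
    [/\ p i = t.1.1 ++ t.1.2 :: t.2, shared i t.1.2 & ~~ has (shared i) t.1.1].
  have : has (shared i) (p i).
    apply/hasP; exists (v (ordS i)) => //; apply/existsP; exists (ordS i).
    by rewrite ordS_neq 1?ltnW ?mem_head.
  by case/split_find => x A B sx A0; exists (A, x, B); rewrite /= -cat_rcons.
have [t tP] := fin_all_exists splitp.
pose A i := (t i).1.1; pose s i := (t i).1.2; pose B i := (t i).2.
have pE i : p i = A i ++ s i :: B i by case: (tP i).
have Apriv i j x : x \in A i -> x \in v j :: p j -> j = i.
  move=> xA xj; case: (tP i) => _ _ /hasPn /(_ _ xA) /existsPn /(_ j).
  by rewrite xj andbT negbK => /eqP.
have sshared i : exists2 j, j != i & s i \in v j :: p j.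
  by case: (tP i) => _ /existsP [j /andP [ji sj]] _; exists j.
have si i : s i \in v i :: p i by rewrite pE inE mem_cat mem_head !orbT.
have [/existsP [k sk]|/existsPn noback] :=
    boolP [exists k, s (ordS k) \in v k :: p k].
  by apply: (reroot_minor n2 S (pE _) sk _ IH) => j x /Apriv; apply.
have sS i : s i \in v (ordS i) :: p (ordS i).
  have [j ji sj] := sshared i.
  case: (consec _ _ _ (si i) sj) => [ij|<- //|ij]; first by rewrite ij eqxx in ji.
  by move: (noback j); rewrite -ij sj.
pose clean i := s i == v (ordS i).
have cleanS i : clean (ordS i) -> clean i.
  move=> cl; have Bnil : B (ordS i) = [::].
    have := uniqP (ordS i); rewrite pE => /last_uniq_nil; apply.
    by rewrite -pE lastP (eqP cl).
  have := sS i; rewrite inE => /orP [//|]; rewrite pE Bnil mem_cat inE.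
  case/orP => [sA|/eqP ss].
    by have := ordS_neq i (ltnW n2); rewrite -(Apriv _ _ _ sA (si i)) eqxx.
  by case: (three_paths n2 S (si i) (sS i)); rewrite ss.
have [/existsP [k ck]|/existsPn nclean] := boolP [exists i, clean i]; last first.
  exact: rotate_minor n2 S pE Apriv sS nclean IH.
have cl := ordS_closed_all cleanS ck.
have subP i : {subset v i :: A i <= v i :: p i}.
  by move=> x xA; rewrite pE -cat_cons mem_cat xA.
exists (fun i => [set x in v i :: A i]); split=> [i|i x|i j x|i|i].
- by rewrite inE mem_head.
- rewrite inE => xA; apply: path_connect_restrict xA.
    by have := pathP i; rewrite pE cat_path => /andP [].
  by move=> y yA; rewrite inE.
- rewrite !inE => /orP [/eqP xvi|xAi] xj.
    case/orP: (xj) => [/eqP xvj|xAj].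
      by apply: (root_inj n2 S); rewrite -xvi.
    by apply: (Apriv _ _ _ xAj); rewrite xvi mem_head.
  by apply/esym/(Apriv _ _ _ xAi)/subP; rewrite inE.
(* Here [s i] is the next root, so the last edge of the path [i] joins the two branch sets. *)
- exists (last (v i) (A i)), (v (ordS i)); rewrite !inE eqxx -in_cons mem_last; split=> //.
  by have := pathP i; rewrite pE -(eqP (cl i)) cat_path /= => /and3P [].
- by apply/subsetP => x; rewrite inE => /subP; apply: mem_support.
Qed.

(** * From schemes of the cycle graph to rooted minors *)

Lemma uv_path_sym (G : sgraph) (u v : G) (s : seq G) :
  uv_path u v s -> uv_path v u (rev s).
Proof.
case: s => // x p /and4P [/eqP <- /eqP <- pp up]; rewrite lastI rev_rcons /=.
rewrite eqxx (_ : _ (rev _) == x) /=; last first.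
  by case: p {pp up} => //= y p; rewrite rev_cons last_rcons.
rewrite rev_path (eq_path (e' := @adj G)) => [|a b]; last by rewrite adj_sym.
by rewrite pp -cons_uniq -rev_rcons -lastI rev_uniq.
Qed.

Lemma subset2_eq (T : finType) (a b u v : T) :
  a != b -> [set a; b] = [set u; v] -> (u = a /\ v = b) \/ (u = b /\ v = a).
Proof.
move=> ab E; have := set22 a b; have := set21 a b; rewrite {}E.
by case/set2P=> ? /set2P [] ?; subst; rewrite ?eqxx // in ab; auto.
Qed.

(** Condition (2) is applied to two and to three edges [[set i; ordS i]]: edges with a common end
    are equal or consecutive, and only two edges meet at a given end. *)
Lemma cyclic_scheme_of_is_scheme n (G : sgraph) (f : cycle_graph n -> G) P :
  2 < n -> is_scheme f P -> exists p, cyclic_scheme f p.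
Proof.
move=> n2 [Ppath Pmeet].
pose e (i : 'I_n) : {set cycle_graph n} := [set i; ordS i].
have iS (i : 'I_n) : i != ordS i by rewrite eq_sym ordS_neq // ltnW.
have eE i : e i \in edges (cycle_graph n).
  rewrite inE; apply/existsP; exists i; apply/existsP; exists (ordS i).
  by rewrite /= /cycle_adj !eqxx iS.
have exp (i : 'I_n) : exists p : seq G,
    uv_path (f i) (f (ordS i)) (f i :: p) /\ f i :: p =i P (e i).
  have [[u [w [euw Puw]]] _] := Ppath _ (eE i).
  (* The list given for an edge may run either way; it is reversed if it starts at [f (ordS i)]. *)
  have [s [sP sE]] : exists s, uv_path (f i) (f (ordS i)) s /\ s =i P (e i).
    case: (subset2_eq (iS i) euw) Puw => -[-> ->] h; first by exists (P (e i)).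
    by exists (rev (P (e i))); split; [apply: uv_path_sym | apply: mem_rev].
  case: s sP sE => // x s sP; have /and4P [/eqP xi _ _ _] := sP.
  by rewrite xi in sP * => sE; exists s.
have [p pP] := fin_all_exists exp.
have pE i : f i :: p i =i P (e i) by case: (pP i).
have pU i : uv_path (f i) (f (ordS i)) (f i :: p i) by case: (pP i).
have inS := can_inj (@ordSK n).
have meet (I : {set 'I_n}) (i0 : 'I_n) x : i0 \in I ->
    {in I, forall i, x \in f i :: p i} -> exists u : 'I_n, {in I, forall i, u = i \/ u = ordS i}.
  move=> i0I xI; case: (Pmeet (e @: I)).
  - by apply/set0Pn; exists (e i0); apply: imset_f.
  - by apply/subsetP => _ /imsetP [i _ ->].
  - by exists x => _ /imsetP [i iI ->]; rewrite -pE; apply: xI.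
  move=> u uI; exists u => i iI; have := uI _ (imset_f e iI).
  by rewrite !inE => /orP [] /eqP; auto.
exists p; split.
- by move=> i; case/and4P: (pU i).
- by move=> i; case/and4P: (pU i) => _ /eqP.
- by move=> i; case/and4P: (pU i).
- move=> i j x xi xj; case: (@meet [set i; j] i x); rewrite ?set21 //.
    by move=> l /set2P [] ->.
  move=> u uI; case: (uI i (set21 _ _)) => ui; case: (uI j (set22 _ _)) => uj.
  + by constructor 1; rewrite -ui.
  + by constructor 3; rewrite -ui.
  + by constructor 2; rewrite -uj.
  + by constructor 1; apply: inS; rewrite -ui.
- move=> i j k x xi xj xk; case: (@meet [set i; j; k] i x).
  + by rewrite !inE eqxx.
  + by move=> l; rewrite !inE => /orP [/orP [] |] /eqP ->.
  move=> u uI.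
  have {}uI l : l \in [:: i; j; k] -> u == l \/ u == ordS l.
    by rewrite !inE orbA => lI; case: (uI l); rewrite ?inE // => <-; auto.
  have eq2 l l' : u == ordS l -> u == ordS l' -> l = l'.
    by move=> /eqP -> /eqP/inS.
  have eq1 l l' : u == l -> u == l' -> l = l' by move=> /eqP <- /eqP.
  have [iI jI kI] : [/\ i \in [:: i; j; k], j \in [:: i; j; k] & k \in [:: i; j; k]].
    by rewrite !inE !eqxx !orbT.
  (* Each of the three indices is [u] or its predecessor, so two of them agree. *)
  by case: (uI i iI) => hi; case: (uI j jI) => hj; case: (uI k kI) => hk;
    by [constructor 1; eauto | constructor 2; eauto | constructor 3; eauto].
Qed.

Lemma subgraph_of_restrict (G : sgraph) (C : {set G}) :
  exists2 D : subgraph G, sub_vertices D = C & sub_adj D = restrict C.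
Proof.
have Rsym : symmetric (restrict C) by move=> x y; rewrite /restrict adj_sym andbCA.
by exists (Subgraph Rsym (fun x y xy => xy)).
Qed.

Theorem theorem4p2 (n : nat) (hn : 3 <= n) : contractible (cycle_graph n).
Proof.
move=> G f _ [P /(cyclic_scheme_of_is_scheme hn) [p /(scheme_minor hn) [C [Cf Cc Cd Ca _]]]].
have [D DC DR] := fin_all_exists2 (fun i => subgraph_of_restrict (C i)).
have Csym i : connect_sym (restrict (C i)).
  by apply: sym_connect_sym => x y; rewrite /restrict adj_sym andbCA.
exists D; split=> [i|i j ij|i|i j].
- split; first by apply/set0Pn; exists (f i); rewrite DC.
  move=> x y; rewrite DC DR => xC yC.
  by apply: connect_trans (Cc _ _ yC); rewrite Csym; apply: Cc.
- rewrite !DC; apply/pred0Pn => -[x /andP [xi xj]].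
  by case/eqP: ij; apply: Cd xi xj.
- by rewrite DC.
- rewrite !DC => /andP [_ /orP [] /eqP ->]; first exact: Ca.
  by have [x [y [xC yC xy]]] := Ca j; exists y, x; rewrite adj_sym.
Qed.
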